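(* It holds that $$\frac{1}{2}\,\square(\mathcal X,\mathcal Y)^2\leq\mathsf d_{\rm mG}(\mathcal X,\mathcal Y)\leq\frac{3}{2}\,\square(\mathcal X,\mathcal Y)\quad\text{ for every }\mathcal X,\mathcal Y\in\mathbb X_1.$$
   Context: ''Isometry'' means distance-preserving map (not necessarily surjective). A normalised metric measure space $({\rm X},\mathsf d,\mathfrak m)$ is a complete separable metric space with a Borel probability measure $\mathfrak m$. Two such spaces are isomorphic if there is an isometric bijection $\phi\colon{\rm spt}(\mathfrak m_{\rm X})\to{\rm spt}(\mathfrak m_{\rm Y})$ with $\phi_\#\mathfrak m_{\rm X}=\mathfrak m_{\rm Y}$. $\mathbb X_1$ is the collection of isomorphism classes $[{\rm X},\mathsf d,\mathfrak m]$ of normalised metric measure spaces. Box distance: let $\mathscr L_1$ be Lebesgue measure on $[0,1)$. A parameter of $\mathfrak m$ is a Borel map $q\colon[0,1)\to{\rm X}$ with $q_\#\mathscr L_1=\mathfrak m$ (parameters always exist). For pseudodistances $\delta_1,\delta_2$ on $[0,1)$, $\square(\delta_1,\delta_2)$ is the infimum of $\varepsilon\in[0,1]$ for which there is a Borel set $I_\varepsilon\subseteq[0,1)$ with $\mathscr L_1(I_\varepsilon)\geq 1-\varepsilon$ and $|\delta_1(t,s)-\delta_2(t,s)|\leq\varepsilon$ for all $t,s\in I_\varepsilon$. With $(q^*\mathsf d)(t,s):=\mathsf d(q(t),q(s))$, set $$\square([{\rm X},\mathsf d_{\rm X},\mathfrak m_{\rm X}],[{\rm Y},\mathsf d_{\rm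 Y},\mathfrak m_{\rm Y}]):=\inf_{q_{\rm X},q_{\rm Y}}\square(q_{\rm X}^*\mathsf d_{\rm X},q_{\rm Y}^*\mathsf d_{\rm Y}),$$ the infimum being over all parameters $q_{\rm X}$ of $\mathfrak m_{\rm X}$ and $q_{\rm Y}$ of $\mathfrak m_{\rm Y}$ (this is independent of representatives). $(\mathbb U,\mathsf d_{\mathbb U})$ is the Urysohn universal metric space: the unique (up to isometric bijection) complete separable metric space that is universal (every separable metric space embeds isometrically in it) and ultrahomogeneous (every isometry $\phi\colon F\to\mathbb U$ on a finite subset $F\subseteq\mathbb U$ extends to an isometric bijection of $\mathbb U$). $\mathscr P(\mathbb U)$ is the set of Borel probability measures on $\mathbb U$; $W(\mu,\nu):=\inf_{\pi}\int\mathsf d_{\mathbb U}\wedge 1\,{\rm d}\pi$, the infimum being over all $\pi\in\mathscr P(\mathbb U\times\mathbb U)$ with marginals $\mu$ and $\nu$. For $\mu,\nu\in\mathscr P(\mathbb U)$, $\mu\sim\nu$ iff $\phi_\#\mu=\nu$ for some isometric bijection $\phi\colon{\rm spt}(\mu)\to{\rm spt}(\nu)$; $\mathscr P_\sim(\mathbb U):=\mathscr P(\mathbb U)/\sim$, and for $\theta,\eta\in\mathscr P_\sim(\mathbb U)$ $$W_H(\theta,\eta):=\max\Big\{\sup_{\mu\in\theta}\inf_{\nu\in\eta}W(\mu,\nu),\ \sup_{\nu\in\eta}\inf_{\mu\in\theta}W(\mu,\nu)\Big\}.$$ The map $\Phi\colon\mathbb X_1\to\mathscr P_\sim(\mathbb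 U)$, $\Phi([{\rm X},\mathsf d,\mathfrak m]):=[f_\#\mathfrak m]$ for any isometry $f\colon{\rm X}\to\mathbb U$, is a well-defined bijection, and $\mathsf d_{\rm mG}(\mathcal X,\mathcal Y):=W_H(\Phi(\mathcal X),\Phi(\mathcal Y))$. *)

(* Defs.v *)
From HB Require Import structures.
From mathcomp Require Import all_boot all_order all_algebra.
From mathcomp Require Import all_classical all_reals all_analysis.
Set Implicit Arguments. Unset Strict Implicit. Unset Printing Implicit Defensive.
Import Order.TTheory GRing.Theory Num.Theory.
Import numFieldNormedType.Exports.
Local Open Scope classical_set_scope.
Local Open Scope ring_scope.

(* Complete and measurable types of the library are pointed. This is harmless
   for a space carrying a probability measure, which is nonempty; ury_universal
   below ranges over metricType, hence also over the empty space. *)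
#[short(type="completeMetricType")]
HB.structure Definition CompleteMetric (R : numDomainType) :=
  {T of Complete T & Metric R T}.

Notation borel T := (g_sigma_algebraType (@open T)).

Definition separable (T : topologicalType) :=
  exists2 D : set T, countable D & dense D.

Definition isometry_on {R : realType} {X Y : metricType R} (A : set X)
    (f : X -> Y) :=
  forall x y, A x -> A y -> mdist (f x) (f y) = mdist x y.

Definition isometry {R : realType} {X Y : metricType R} (f : X -> Y) :=
  forall x y, mdist (f x) (f y) = mdist x y.

Definition spt {R : realType} {X : completeMetricType R}
    (m : probability (borel X) R) : set X :=
  [set x | forall V : set X, open V -> V x -> (0 < m V)%E].

(* Only the restriction of phi to spt m matters: the last condition says that
   n is the image of m under phi : spt m -> spt n. *)
Definition iso_meas {R : realType} {X Y : completeMetricType R}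
    (m : probability (borel X) R) (n : probability (borel Y) R) :=
  exists phi : X -> Y,
    [/\ set_bij (spt m) (spt n) phi,
        isometry_on (spt m) phi &
        forall B : set (borel Y), measurable B ->
          n B = m (spt m `&` phi @^-1` B)].

Section quotient.
Context {T : Type} (r : T -> T -> Prop).

(* Equivalence classes, as sets. *)
Definition classes := {A : set T | exists x, A = [set y | r x y]}.

Definition class_of (x : T) : classes :=
  exist _ [set y | r x y] (ex_intro _ x erefl).

Definition rep (A : classes) : T := sval (cid (svalP A)).

Lemma class_of_rep (A : classes) : class_of (rep A) = A.
Proof.
case: A => A hA; apply: eq_exist; rewrite /rep /=.
by case: (cid _) => x /= ->.
Qed.

Hypothesis r_refl : forall x, r x x.
Hypothesis r_sym : forall x y, r x y -> r y x.
Hypothesis r_trans : forall x y z, r x y -> r y z -> r x z.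

Lemma class_ofP x y : class_of x = class_of y <-> r x y.
Proof.
split=> [/(congr1 sval)/= xy|xy].
  have : [set z | r y z] y by exact: r_refl.
  by rewrite -xy.
apply: eq_exist; apply/seteqP; split => z /=; last exact: r_trans.
by apply: r_trans; exact: r_sym.
Qed.

Lemma rep_class_of x : r x (rep (class_of x)).
Proof. by apply/class_ofP; rewrite class_of_rep. Qed.

End quotient.

Record mmspace (R : realType) := MMSpace {
  mm_space :> completeMetricType R ;
  mm_separable : separable mm_space ;
  mm_meas : probability (borel mm_space) R }.

Definition mm_iso {R : realType} (X Y : mmspace R) :=
  iso_meas (mm_meas X) (mm_meas Y).

Definition X1 (R : realType) := classes (@mm_iso R).

Record urysohn (R : realType) := Urysohn {
  ury_space :> completeMetricType R ;
  ury_separable : separable ury_space ;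
  ury_universal : forall T : metricType R, separable T ->
    exists f : T -> ury_space, isometry f ;
  ury_homogeneous : forall (F : set ury_space) (phi : ury_space -> ury_space),
    finite_set F -> isometry_on F phi ->
    exists psi : ury_space -> ury_space,
      [/\ isometry psi, bijective psi & {in F, phi =1 psi}] }.

Section box.
Context {R : realType}.

(* The parameters, the pseudodistances and the sets I live on [0, 1[; they are
   represented by functions on R, whose values off [0, 1[ play no role, and by
   subsets of R. *)
Definition is_parameter {X : completeMetricType R}
    (m : probability (borel X) R) (q : measurableTypeR R -> borel X) :=
  measurable_fun (`[0 : R, 1 : R[%classic : set (measurableTypeR R)) q /\
  forall B : set (borel X), measurable B ->
    lebesgue_measure (`[0 : R, 1 : R[ `&` q @^-1` B) = m B.

Definition box_dist (d1 d2 : R -> R -> R) : \bar R :=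
  ereal_inf [set e%:E | e in [set e : R | 0 <= e <= 1 /\
    exists I : set (measurableTypeR R),
      [/\ measurable I, I `<=` `[0 : R, 1 : R[,
          ((1 - e)%:E <= lebesgue_measure I)%E &
          forall t s, I t -> I s -> `|d1 t s - d2 t s| <= e]]].

Definition pullback {X : metricType R} (q : R -> X) (t s : R) : R :=
  mdist (q t) (q s).

Definition box_mm (X Y : mmspace R) : \bar R :=
  ereal_inf [set e | exists (qX : R -> X) (qY : R -> Y),
    [/\ is_parameter (mm_meas X) qX, is_parameter (mm_meas Y) qY &
        e = box_dist (pullback qX) (pullback qY)]].

(* The choice of representatives is irrelevant, see boxE below. *)
Definition box (x y : X1 R) : \bar R := box_mm (rep x) (rep y).

End box.

Section wasserstein.
Context {R : realType} (U : urysohn R).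
Local Open Scope ereal_scope.

(* The sigma-algebra of borel (U * U) is generated by the open sets of the
   product topology. *)
Definition is_coupling (mu nu : probability (borel U) R)
    (p : probability (borel (U * U)%type) R) :=
  (forall A : set (borel U), measurable A -> p (A `*` setT) = mu A) /\
  (forall A : set (borel U), measurable A -> p (setT `*` A) = nu A).

Definition W (mu nu : probability (borel U) R) : \bar R :=
  ereal_inf [set \int[p]_z (Num.min (mdist z.1 z.2) 1%R)%:E
            | p in [set p | is_coupling mu nu p]].

Definition sim (mu nu : probability (borel U) R) := iso_meas mu nu.

Definition Psim := classes sim.

Definition W_H (theta eta : Psim) : \bar R :=
  maxe (ereal_sup [set ereal_inf [set W mu nu | nu in sval eta]
                  | mu in sval theta])
       (ereal_sup [set ereal_inf [set W mu nu | mu in sval theta]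
                  | nu in sval eta]).

End wasserstein.

Section measurability_isometry.
Context {R : realType}.

Lemma open_borel (X : completeMetricType R) (V : set X) :
  open V -> measurable (V : set (borel X)).
Proof. exact: sub_sigma_algebra. Qed.

Lemma closed_borel (X : completeMetricType R) (V : set X) :
  closed V -> measurable (V : set (borel X)).
Proof.
move=> cV; rewrite -[V]setCK; apply: measurableC; apply: open_borel.
exact: closed_openC.
Qed.

Lemma open_ball_metric (X : metricType R) (x : X) (r : R) : open (ball x r).
Proof.
rewrite openE => y; rewrite ballEmdist /= => xy.
apply/nbhs_ballP; exists (r - mdist x y); first by rewrite /= subr_gt0.
move=> z; rewrite !ballEmdist /= ltrBrDl => yz.
exact: le_lt_trans (metric_triangle x y z) yz.
Qed.

Lemma measurable_isometry_on (X Y : completeMetricType R) (A : set X)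
    (f : X -> Y) :
  closed A -> isometry_on A f ->
  measurable_fun (A : set (borel X)) (f : borel X -> borel Y).
Proof.
move=> cA fA; apply: (@measurability _ _ (borel X) (borel Y) A f (@open Y)) => //.
move=> _ [B oB <-].
pose V := \bigcup_(W in [set W : set X | open W /\ A `&` W `<=` f @^-1` B]) W.
have -> : A `&` f @^-1` B = A `&` V.
  apply/seteqP; split => x [Ax Bx]; split => //; last first.
    by case: Bx => W [_ AW] Wx; exact: AW.
  have /nbhs_ballP[e /= e0 eB] : nbhs (f x) B by exact: open_nbhs_nbhs.
  exists (ball x e); last exact: ballxx.
  split; first exact: open_ball_metric.
  move=> y [Ay]; rewrite ballEmdist /= => xy; apply: eB.
  by rewrite ballEmdist /= fA.
apply: measurableI; first exact: closed_borel.
by apply: open_borel; apply: bigcup_open => W [].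
Qed.

Lemma measurable_isometry (X Y : completeMetricType R) (f : X -> Y) :
  isometry f -> measurable_fun [set: borel X] (f : borel X -> borel Y).
Proof.
move=> fi; apply: measurable_isometry_on; first exact: closedT.
by move=> x y _ _; exact: fi.
Qed.

Lemma closed_spt (X : completeMetricType R) (m : probability (borel X) R) :
  closed (spt m).
Proof.
move=> x sx V oV Vx; have [y [sy Vy]] := sx V (open_nbhs_nbhs (conj oV Vx)).
exact: sy.
Qed.

Lemma spt_null (X : completeMetricType R) (m : probability (borel X) R) :
  separable X -> m (~` spt m) = 0%E.
Proof.
move=> [D /countable_injP[g ginj] dD].
have mS : measurable (~` spt m : set (borel X)).
  by apply: measurableC; apply: closed_borel; exact: closed_spt.
apply/negligibleP => //.
pose B (n k : nat) := [set x : X | exists d : X,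
  [/\ D d, g d = n, m (ball d k.+1%:R^-1) = 0%E & ball d k.+1%:R^-1 x]].
have nB n k : m.-negligible (B n k : set (borel X)).
  have [[d [Dd gd md]]|nd] := pselect (exists d : X,
      [/\ D d, g d = n & m (ball d k.+1%:R^-1) = 0%E]); last first.
    suff -> : B n k = set0 by exact: negligible_set0.
    by apply/seteqP; split => // x [d [Dd gd md _]]; case: nd; exists d.
  exists (ball d k.+1%:R^-1); split => //.
    by apply: open_borel; exact: open_ball_metric.
  move=> x [d' [Dd' gd' _]].
  by rewrite (ginj d' d) ?inE ?gd'.
have : m.-negligible (\bigcup_n \bigcup_k B n k : set (borel X)).
  by apply: negligible_bigcup => n; apply: negligible_bigcup => k; exact: nB.
apply: negligibleS => x /= /existsNP[V /not_implyP[oV /not_implyP[Vx /negP]]].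
rewrite -leNgt => mV.
have /nbhs_ballP[e /= e0 eV] : nbhs x V by exact: open_nbhs_nbhs.
pose k := Num.truncn (e / 2)^-1.
have e2 : 0 < e / 2 by rewrite divr_gt0.
have ke : k.+1%:R^-1 < e / 2.
  by rewrite -[ltRHS]invrK ltf_pV2 ?posrE ?invr_gt0//; exact: truncnS_gt.
have k0 : (0 : R) < k.+1%:R^-1 by rewrite invr_gt0.
have [d [xd Dd]] : ball x k.+1%:R^-1 `&` D !=set0.
  apply: dD; last exact: open_ball_metric.
  by exists x; exact: ballxx.
exists (g d) => //; exists k => //; exists d; split => //; last exact: ball_sym.
apply/eqP; rewrite eq_le measure_ge0 andbT; apply: le_trans mV.
apply: le_measure; rewrite ?inE.
- by apply: open_borel; exact: open_ball_metric.
- exact: open_borel.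
- move=> y dy; apply: eV; rewrite (splitr e).
  apply: (@ball_triangle _ _ d); apply: le_ball; [exact: ltW ke|exact: xd
    |exact: ltW ke|exact: dy].
Qed.

Lemma sptI (X : completeMetricType R) (m : probability (borel X) R)
    (A : set (borel X)) :
  separable X -> measurable A -> m (spt m `&` A) = m A.
Proof.
move=> sX mA.
have mS : measurable (spt m : set (borel X)).
  by apply: closed_borel; exact: closed_spt.
have mA' : m (A `\` spt m) = 0%E.
  apply/eqP; rewrite eq_le measure_ge0 andbT -(spt_null m sX).
  apply: le_measure; rewrite ?inE; [exact: measurableD|exact: measurableC|].
  by move=> x [].
have -> : m A = (m (A `&` spt m) + m (A `\` spt m))%E.
  rewrite -measureU.
  - by rewrite setUIDK.
  - exact: measurableI.
  - exact: measurableD.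
  - by apply/seteqP; split => x // [[_ ?] []].
by rewrite mA' adde0 setIC.
Qed.

Lemma measurable_spt_preimage (X Y : completeMetricType R)
    (m : probability (borel X) R) (phi : X -> Y) (B : set (borel Y)) :
  isometry_on (spt m) phi -> measurable B ->
  measurable (spt m `&` phi @^-1` B : set (borel X)).
Proof.
move=> phii mB; have cS := @closed_spt _ m.
by apply: (measurable_isometry_on cS phii) => //; exact: closed_borel.
Qed.

Lemma iso_meas_refl (X : completeMetricType R) (m : probability (borel X) R) :
  separable X -> iso_meas m m.
Proof.
move=> sX; exists id; split => //.
  by split=> [x mx|x y _ _|x mx] //; exists x.
by move=> B mB; rewrite sptI.
Qed.

Lemma iso_meas_sym (X Y : completeMetricType R) (m : probability (borel X) R)
    (n : probability (borel Y) R) :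
  separable X -> iso_meas m n -> iso_meas n m.
Proof.
move=> sX [phi [phib phii phim]].
have [phif phij phis] := phib.
pose psi y := xget point [set x | spt m x /\ phi x = y].
have psiP y : spt n y -> spt m (psi y) /\ phi (psi y) = y.
  by move=> ny; have [x mx xy] := phis y ny; rewrite /psi; case: xgetP => [x' ->//|/(_ x)[]].
have psiK x : spt m x -> psi (phi x) = x.
  move=> mx; have [h1 h2] := psiP (phi x) (phif _ mx).
  by apply: phij; rewrite ?inE.
have psii : isometry_on (spt n) psi.
  move=> y z ny nz; have [hy {2}<-] := psiP _ ny; have [hz {2}<-] := psiP _ nz.
  by rewrite phii.
exists psi; split => //.
  split.
  - by move=> y ny; have [] := psiP _ ny.
  - move=> y z; rewrite !inE => ny nz yz.
    by have [_ <-] := psiP _ ny; have [_ <-] := psiP _ nz; rewrite yz.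
  - move=> x mx; exists (phi x); first exact: phif _ mx.
    exact: psiK.
move=> B mB; rewrite phim; last exact: measurable_spt_preimage.
rewrite -(sptI m sX mB); congr (m _); apply/seteqP; split=> x [mx].
- by move=> Bx; split => //; split; [exact: phif _ mx|rewrite /= psiK].
- by move=> [_]; rewrite /= psiK.
Qed.

Lemma iso_meas_trans (X Y Z : completeMetricType R)
    (m : probability (borel X) R) (n : probability (borel Y) R)
    (p : probability (borel Z) R) :
  iso_meas m n -> iso_meas n p -> iso_meas m p.
Proof.
move=> [phi [phib phii phim]] [psi [psib psii psim]].
have [phif _ _] := phib.
exists (psi \o phi); split; first exact: set_bij_comp phib psib.
- by move=> x y mx my; rewrite /= psii ?phii//; exact: phif.
- move=> B mB; rewrite psim// phim; last exact: measurable_spt_preimage.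
  congr (m _); apply/seteqP; split=> x [mx] //=; first by move=> [].
  by move=> Bx; split => //; split => //; exact: phif _ mx.
Qed.

End measurability_isometry.

Section box_invariance.
Context {R : realType}.

Let I01 : set (measurableTypeR R) := `[0 : R, 1 : R[.

Lemma mm_iso_refl (X : mmspace R) : mm_iso X X.
Proof. by apply: iso_meas_refl; exact: mm_separable. Qed.

Lemma mm_iso_sym (X Y : mmspace R) : mm_iso X Y -> mm_iso Y X.
Proof. by apply: iso_meas_sym; exact: mm_separable. Qed.

Lemma mm_iso_trans (X Y Z : mmspace R) :
  mm_iso X Y -> mm_iso Y Z -> mm_iso X Z.
Proof. exact: iso_meas_trans. Qed.

Lemma le_box_dist (N : set (measurableTypeR R)) (d1 d1' d2 d2' : R -> R -> R) :
  measurable N -> lebesgue_measure (I01 `\` N) = 0%E ->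
  (forall t s, N t -> N s -> d1 t s = d1' t s) ->
  (forall t s, N t -> N s -> d2 t s = d2' t s) ->
  (box_dist d1 d2 <= box_dist d1' d2')%E.
Proof.
move=> mN N0 d11' d22'; apply: ereal_inf_le_tmp => _ [e [e01 [I [mI I1 Ie Id]]] <-].
exists e => //; split => //; exists (I `&` N); split.
- exact: measurableI.
- by move=> t [/I1].
- apply: le_trans Ie _.
  have -> : lebesgue_measure I =
      (lebesgue_measure (I `&` N) + lebesgue_measure (I `\` N))%E.
    rewrite -measureU.
    + by rewrite setUIDK.
    + exact: measurableI.
    + exact: measurableD.
    + by apply/seteqP; split => x // [[_ ?] []].
  rewrite [X in (_ + X)%E](_ : _ = 0%E) ?adde0//.
  apply/eqP; rewrite eq_le measure_ge0 andbT -N0.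
  apply: le_measure; rewrite ?inE; [exact: measurableD| |].
    by apply: measurableD => //; exact: measurable_itv.
  by move=> t [/I1 ? ?].
- by move=> t s [It Nt] [Is Ns]; rewrite d11'// d22'//; exact: Id.
Qed.

Lemma parameter_transfer (X Y : mmspace R) (q : R -> X) :
  mm_iso X Y -> is_parameter (mm_meas X) q ->
  exists q' : R -> Y, is_parameter (mm_meas Y) q' /\
    exists N : set (measurableTypeR R), [/\ measurable N,
      lebesgue_measure (I01 `\` N) = 0%E &
      forall t s, N t -> N s -> pullback q t s = pullback q' t s].
Proof.
move=> [phi [[phif _ _] phii phim]] [mq qm].
pose S := spt (mm_meas X).
have mS : measurable (S : set (borel X)).
  by apply: closed_borel; exact: closed_spt.
have mI01 : measurable I01 by exact: measurable_itv.
pose N : set (measurableTypeR R) := I01 `&` q @^-1` S.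
have mN : measurable N by exact: mq.
have N0 : lebesgue_measure (I01 `\` N) = 0%E.
  rewrite [X in lebesgue_measure X](_ : _ = I01 `&` q @^-1` (~` S)).
    by rewrite qm; [exact: spt_null (@mm_separable _ X)|exact: measurableC].
  apply/seteqP; split => t [It nt]; split => //; first by move=> St; exact: nt.
  by move=> [].
pose q' t := if `[< S (q t) >] then phi (q t) else point.
have q'E (B : set (borel Y)) :
    N `&` q' @^-1` B = I01 `&` q @^-1` (S `&` phi @^-1` B).
  apply/seteqP; split => t /=; rewrite /q'.
    by move=> [[It St]]; rewrite asboolT.
  by move=> [It [St Bt]]; rewrite asboolT.
have q'E' (B : set (borel Y)) : I01 `&` q' @^-1` B =
    (N `&` q' @^-1` B) `|` ((I01 `\` N) `&` q' @^-1` B).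
  by rewrite -setIUl setDUK//; exact: subIsetl.
have mq'D (B : set (borel Y)) : measurable ((I01 `\` N) `&` q' @^-1` B).
  have [Bp|nBp] := pselect (B point).
    rewrite (_ : _ `&` _ = I01 `\` N); first exact: measurableD.
    apply/seteqP; split=> [t []//|t [It nt]]; split => //.
    by rewrite /q' /= asboolF// => St; exact: nt.
  rewrite (_ : _ `&` _ = set0)//; apply/seteqP; split => // t [[It nt]].
  by rewrite /q' /= asboolF// => St; exact: nt.
have mq'N (B : set (borel Y)) : measurable B -> measurable (N `&` q' @^-1` B).
  move=> mB; rewrite q'E; apply: mq => //.
  exact: measurable_spt_preimage.
exists q'; split; last first.
  exists N; split => // t s [_ St] [_ Ss].
  by rewrite /pullback /q' !asboolT// phii.
split=> [_ B mB|B mB].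
  by rewrite q'E'; apply: measurableU; [exact: mq'N|exact: mq'D].
rewrite q'E' measureU; first last.
- by apply/seteqP; split => // t [[Nt _] [[_ nt] _]].
- exact: mq'D.
- exact: mq'N.
rewrite [X in (_ + X)%E](_ : _ = 0%E).
  rewrite adde0 q'E phim//; apply: qm.
  exact: measurable_spt_preimage.
apply/eqP; rewrite eq_le measure_ge0 andbT -N0.
apply: le_measure; rewrite ?inE; [exact: mq'D|exact: measurableD|].
exact: subIsetl.
Qed.

Lemma le_box_mm (X X' Y Y' : mmspace R) : mm_iso X X' -> mm_iso Y Y' ->
  (box_mm X Y <= box_mm X' Y')%E.
Proof.
move=> /mm_iso_sym XX' /mm_iso_sym YY'.
apply: le_ereal_inf_tmp => _ [qX [qY [pX pY ->]]].
have [qX' [pX' [N [mN N0 XN]]]] := parameter_transfer XX' pX.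
have [qY' [pY' [M [mM M0 YM]]]] := parameter_transfer YY' pY.
apply: ge_ereal_inf; exists (box_dist (pullback qX') (pullback qY')).
  by exists qX', qY'.
apply: (@le_trans _ _ (box_dist (pullback qX) (pullback qY'))).
  by apply: (le_box_dist mN N0) => // t s Nt Ns; rewrite XN.
by apply: (le_box_dist mM M0) => // t s Nt Ns; rewrite YM.
Qed.

Lemma boxE (X Y : mmspace R) :
  box (class_of (@mm_iso R) X) (class_of (@mm_iso R) Y) = box_mm X Y.
Proof.
have rX := rep_class_of mm_iso_refl mm_iso_sym mm_iso_trans X.
have rY := rep_class_of mm_iso_refl mm_iso_sym mm_iso_trans Y.
by apply/eqP; rewrite eq_le !le_box_mm//; exact: mm_iso_sym.
Qed.

End box_invariance.

Section mG.
Context {R : realType}.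

Section image_meas.
Context {X Y : completeMetricType R} (f : X -> Y) (fi : isometry f).
Variable m : probability (borel X) R.

(* f_# m *)
Definition image_meas : probability (borel Y) R :=
  distribution m (mfun_Sub (mem_set (measurable_isometry fi))).

Lemma image_measE (B : set (borel Y)) : image_meas B = m (f @^-1` B).
Proof. by []. Qed.

Lemma isometry_preimage_ball (x : X) (e : R) :
  f @^-1` ball (f x) e = ball x e.
Proof. by apply/seteqP; split=> z; rewrite /preimage /= !ballEmdist /= fi. Qed.

Lemma isometry_closed_range (y : Y) :
  (forall e, 0 < e -> f @^-1` ball y e !=set0) -> exists x, f x = y.
Proof.
move=> yf.
pose F : set_system X := [set A | exists2 e : R, 0 < e & f @^-1` ball y e `<=` A].
have FF : ProperFilter F.
  split; first by move=> [e e0 sub0]; have [x /sub0] := yf e e0.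
  split; first by exists 1.
  - move=> A B [e e0 eA] [d d0 dB]; exists (Num.min e d).
      by rewrite lt_min e0.
    move=> x xy; split; [apply: eA|apply: dB]; apply: le_ball xy;
    by rewrite ge_min lexx ?orbT.
  - by move=> A B AB [e e0 eA]; exists e => //; exact: subset_trans eA AB.
have cF : cauchy F.
  apply: cauchy_exP => e e0; have e2 : 0 < e / 2 by rewrite divr_gt0.
  have [x yx] := yf _ e2.
  exists x, (e / 2) => // z yz; rewrite -isometry_preimage_ball /= (splitr e).
  by apply: ball_triangle yz; exact: ball_sym.
have Fl : F --> lim F by exact: cauchy_cvg.
exists (lim F); apply: mdist_positivity; apply/eqP; rewrite eq_le mdist_ge0 andbT.
apply/ler_addgt0Pl => e e0; rewrite addr0.
have e2 : 0 < e / 2 by rewrite divr_gt0.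
have [d d0 dF] : F (ball (lim F) (e / 2)) by apply: Fl; exact: nbhsx_ballx.
have md0 : 0 < Num.min d (e / 2) by rewrite lt_min d0.
have [x yx] := yf _ md0.
have : ball (f (lim F)) e y.
  rewrite (splitr e); apply: (@ball_triangle _ _ (f x)).
    rewrite -[ball _ _ _]/((f @^-1` ball (f (lim F)) (e / 2)) x).
    rewrite isometry_preimage_ball; apply: dF.
    by apply: le_ball yx; rewrite ge_min lexx.
  by apply: ball_sym; apply: le_ball yx; rewrite ge_min lexx orbT.
by rewrite ballEmdist /= => /ltW.
Qed.

Lemma iso_image_meas : separable X -> iso_meas m image_meas.
Proof.
move=> sX; exists f; split; last 2 first.
- by move=> x y _ _; exact: fi.
- move=> B mB; rewrite sptI//.
  by rewrite -[X in measurable X]setTI; exact: measurable_isometry.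
split.
- move=> x mx V oV Vx; apply: mx => //.
  change (open (f @^-1` V)); rewrite openE => z Vz; have /nbhs_ballP[e /= e0 eV] : nbhs (f z) V.
    exact: open_nbhs_nbhs.
  apply/nbhs_ballP; exists e => //=; rewrite -isometry_preimage_ball.
  by move=> t; exact: eV.
- move=> x y _ _ xy; apply: mdist_positivity; rewrite -fi xy; exact: mdistxx.
- move=> y my.
  have ym e : 0 < e -> (0 < m (f @^-1` ball y e))%E.
    by move=> e0; apply: my; [exact: open_ball_metric|exact: ballxx].
  have [|x xy] := @isometry_closed_range y.
    move=> e e0; apply/set0P/eqP => eq0.
    by have := ym e e0; rewrite eq0 measure0 ltxx.
  exists x => // V oV Vx.
  have /nbhs_ballP[e /= e0 eV] : nbhs x V by exact: open_nbhs_nbhs.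
  apply: (lt_le_trans (ym _ e0)); rewrite -xy isometry_preimage_ball.
  by apply: le_measure; rewrite ?inE//; apply: open_borel => //;
    exact: open_ball_metric.
Qed.

End image_meas.

Variable U : urysohn R.

Definition embedding (X : mmspace R) : X -> U :=
  sval (cid (ury_universal U (@mm_separable _ X))).

Lemma embedding_isometry (X : mmspace R) : isometry (@embedding X).
Proof. exact: svalP (cid (ury_universal U (@mm_separable _ X))). Qed.

(* The choice of the representative and of the isometry is irrelevant, see
   PhiE below. *)
Definition Phi (x : X1 R) : Psim U :=
  class_of (@sim _ U) (image_meas (@embedding_isometry (rep x)) (mm_meas (rep x))).

Lemma PhiE (X : mmspace R) (f : X -> U) (fi : isometry f) :
  Phi (class_of (@mm_iso R) X) = class_of (@sim _ U) (image_meas fi (mm_meas X)).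
Proof.
apply/class_ofP.
- by move=> mu; apply: iso_meas_refl; exact: ury_separable.
- by move=> mu nu; apply: iso_meas_sym; exact: ury_separable.
- by move=> mu nu p; exact: iso_meas_trans.
set Y := rep _.
have XY : mm_iso X Y by exact: rep_class_of mm_iso_refl mm_iso_sym mm_iso_trans X.
apply: (@iso_meas_trans _ _ Y _ _ (mm_meas Y)).
  by apply: iso_meas_sym; [|apply: iso_image_meas]; exact: mm_separable.
apply: (@iso_meas_trans _ _ X _ _ (mm_meas X)); first exact: mm_iso_sym.
by apply: iso_image_meas; exact: mm_separable.
Qed.

Definition d_mG (x y : X1 R) : \bar R := W_H (Phi x) (Phi y).

End mG.

(* Main.v *)
(* Lower bound: a coupling p of mu and nu is the law of (q1, q2) for Borel maps
   q1, q2 defined on [0, 1), which are then parameters of mu and nu. If the cost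
   of p is at most e^2 / 2, Markov's inequality gives d(q1 t, q2 t) <= e / 2
   outside a set of measure e, and there the pulled-back distances differ by at
   most e. The maps q1, q2 come from coding a point by the balls of a countable
   family containing it, reading the code as a ternary expansion, and composing
   a Borel decoder with the quantile function of the law of the code.

   Upper bound: let mu live on U and let q1, q2, I, e witness the box distance
   to Y. Gluing U and Y along q1 t ~ q2 t (t in I) at distance e / 2 and
   embedding the result in U moves q1 t and q2 t to points at distance e / 2,
   but it also moves mu. As W_H takes a supremum over all mu in the class, mu has
   to be brought back: this is possible up to an arbitrarily small error, since
   ultrahomogeneity undoes the displacement on a finite set which is a net for
   almost all of mu. The identity coupling of the parameters then costs at most
   e / 2 on I and 1 off I, where the measure is at most e. *)
From HB Require Import structures.
Require Import Defs.
From mathcomp Require Import all_boot all_order all_algebra.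
From mathcomp Require Import all_classical all_reals all_analysis measurable_realfun.
From mathcomp Require Import lra.
Set Implicit Arguments. Unset Strict Implicit. Unset Printing Implicit Defensive.
Import Order.TTheory GRing.Theory Num.Theory.
Import numFieldNormedType.Exports.
Local Open Scope classical_set_scope.
Local Open Scope ring_scope.

(** * Coding bit sequences by real numbers *)

Section ternary_code.
Context {R : realType}.
Implicit Type b : nat -> bool.

(** The recursion peels off the first bit instead of appending a last digit, so that [ternaryS] is
    obtained by passing to the limit. *)
Fixpoint ternary_approx (n : nat) b : R :=
  if n is m.+1 then (2 * (b 0%N)%:R + ternary_approx m (b \o succn)) / 3 else 0.

(* Only the ternary digits 0 and 2 occur, so that comparing with 1/2 reads off the
   first bit. *)
Definition ternary b : R := limn (fun n => ternary_approx n b).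

(** Iterates the map that deletes the leading ternary digit, found by comparison with 1/2. On values
    of [ternary] it acts as the shift of bit sequences. *)
Fixpoint ternary_tail (j : nat) (r : R) : R :=
  if j is i.+1 then let s := ternary_tail i r in 3 * s - 2 * (2^-1 < s)%R%:R else r.

Definition ternary_digit (j : nat) (r : R) : bool := 2^-1 < ternary_tail j r.

Lemma ternary_approx_itv n b : 0 <= ternary_approx n b <= 1.
Proof.
elim: n b => [b|n IH b] /=; first by rewrite lexx ler01.
by have := IH (b \o succn); case: (b 0%N) => /=; lra.
Qed.

Lemma ternary_approx_nd b : nondecreasing_seq (fun n => ternary_approx n b).
Proof.
apply/nondecreasing_seqP => n; elim: n b => [b|n IH b].
  by have /andP[] := ternary_approx_itv 1 b.
by move: (IH (b \o succn)) => /=; lra.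
Qed.

Lemma ternary_cvg b : ternary_approx n b @[n --> \oo] --> ternary b.
Proof.
apply: nondecreasing_is_cvgn; first exact: ternary_approx_nd.
by exists 1 => _ [n _ <-]; have /andP[] := ternary_approx_itv n b.
Qed.

Lemma ternary_itv b : 0 <= ternary b <= 1.
Proof.
have cv := cvgP _ (@ternary_cvg b).
apply/andP; split.
- by apply: limr_ge => //; near=> n; have /andP[] := ternary_approx_itv n b.
- by apply: limr_le => //; near=> n; have /andP[] := ternary_approx_itv n b.
Unshelve. all: by end_near. Qed.

Lemma ternaryS b : ternary b = (2 * (b 0%N)%:R + ternary (b \o succn)) / 3.
Proof.
have h1 : ternary_approx n.+1 b @[n --> \oo] --> ternary b.
  by rewrite (cvg_shiftS (fun n => ternary_approx n b)); exact: ternary_cvg.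
have h2 : ternary_approx n.+1 b @[n --> \oo] -->
    (2 * (b 0%N)%:R + ternary (b \o succn)) / 3.
  rewrite /=; apply: cvgMl; apply: cvgD; first exact: cvg_cst.
  exact: ternary_cvg.
exact: (cvg_unique _ h1 h2).
Qed.

(** By [ternaryS] the value is at most 1/3 when the first bit is 0 and at least 2/3 when it is 1. *)
Lemma ternary_half b : (2^-1 < ternary b) = b 0%N.
Proof.
rewrite ternaryS; have := ternary_itv (b \o succn).
by case: (b 0%N) => /= ?; [apply/idP; lra|apply/negbTE; lra].
Qed.

Lemma ternary_tailE j b : ternary_tail j (ternary b) = ternary (b \o addn j).
Proof.
elim: j => [|j IH] //=.
rewrite IH ternary_half (ternaryS (b \o addn j)) /=.
have -> : (b \o addn j) \o succn = b \o addn j.+1.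
  by apply/funext => i /=; rewrite addnS.
by lra.
Qed.

Lemma ternaryK j b : ternary_digit j (ternary b) = b j.
Proof. by rewrite /ternary_digit ternary_tailE ternary_half /= addn0. Qed.

Lemma measurable_ternary_tail j :
  measurable_fun [set: measurableTypeR R] (ternary_tail j).
Proof.
elim: j => [|j IH]; first exact: measurable_id.
apply: measurable_funB; first exact: measurable_funM.
apply: measurable_funM => //.
apply: (@measurable_comp _ _ _ _ _ _ setT (fun c : bool => c%:R : R)) => //.
exact: measurable_fun_ltr.
Qed.

Lemma measurable_ternary_digit j :
  measurable_fun [set: measurableTypeR R] (ternary_digit j).
Proof. by apply: measurable_fun_ltr => //; exact: measurable_ternary_tail. Qed.

Lemma measurable_ternary d (T : measurableType d) (b : T -> nat -> bool) :
  (forall j, measurable_fun setT (b ^~ j)) ->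
  measurable_fun setT (fun t => ternary (b t)).
Proof.
move=> mb; apply: (@measurable_fun_cvg _ _ _ _ (fun n t => ternary_approx n (b t))).
  move=> n; elim: n b mb => [b mb|n IH b mb] /=; first exact: measurable_cst.
  apply: measurable_funM => //; apply: measurable_funD.
    apply: measurable_funM => //.
    by apply: (@measurable_comp _ _ _ _ _ _ setT (fun c : bool => c%:R : R)).
  by apply: (IH (fun t => b t \o succn)) => j; exact: mb.
by move=> t _; exact: ternary_cvg.
Qed.

End ternary_code.

(** * Quantile functions *)

Section quantile.
Context {R : realType}.

(** The open upper half-lines are stable under intersection and generate the sigma-algebra. *)
Lemma probability_R_ext (P P' : probability (measurableTypeR R) R) :
  (forall r : R, P `]r, +oo[%classic = P' `]r, +oo[%classic) ->
  forall A, measurable A -> P A = P' A.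
Proof.
move=> PP' A mA.
apply: (@measure_unique _ R (measurableTypeR R) (@RGenOInfty.G R) (fun n => `](- n%:R)%R, +oo[%classic)
  _ _ _ _ P P' _ _ A mA).
- exact: RGenOInfty.measurableE.
- move=> _ _ [a ->] [b ->]; exists (Num.max a b).
  apply/seteqP; split => x /=; rewrite !in_itv /= !andbT gt_max.
    by move=> [-> ->].
  by move=> /andP[].
- by move=> n; exists (- n%:R).
- rewrite -subTset => x _; exists (Num.truncn `|x|).+1 => //=.
  rewrite in_itv /= andbT ltrNl; apply: le_lt_trans (truncnS_gt _).
  by rewrite -normrN ler_norm.
- by move=> _ [r ->]; exact: PP'.
- by move=> k; rewrite (le_lt_trans (probability_le1 _ _)) ?ltry.
Qed.

Let measurable_itv01 : measurable (`[0, 1[%classic : set (measurableTypeR R)).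
Proof. exact: measurable_itv. Qed.

(** Lebesgue measure on [0, 1[ seen as a probability on the whole line, so that laws of total maps
    are available through [distribution]. *)
Definition uniform01 : set (measurableTypeR R) -> \bar R :=
  mrestr (@lebesgue_measure R) measurable_itv01.

HB.instance Definition _ := Measure.on uniform01.

Let uniform01_setT : uniform01 setT = 1%E.
Proof. by rewrite /uniform01 /mrestr setTI lebesgue_measure_itv /= lte01 oppr0 adde0. Qed.

HB.instance Definition _ :=
  @Measure_isProbability.Build _ _ R uniform01 uniform01_setT.

Lemma uniform01E A : uniform01 A = lebesgue_measure (`[0 : R, 1 : R[%classic `&` A).
Proof. by rewrite setIC. Qed.

(** With [G] the distribution function, the generalised inverse satisfies r < Q t iff G r < t. Up to
    the null point 0, the set where Q exceeds r is therefore ]G r, 1[, whose length is P ]r,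
    +oo[. *)
Lemma quantile_ex (P : probability (measurableTypeR R) R) :
  exists Q : measurableTypeR R -> measurableTypeR R, measurable_fun setT Q /\
    forall A, measurable A ->
      lebesgue_measure (`[0 : R, 1 : R[%classic `&` Q @^-1` A) = P A.
Proof.
have midR : @measurable_fun _ _ (measurableTypeR R) R setT id by exact: measurable_id.
pose X : {RV P >-> R} := @mfun_Sub _ _ (measurableTypeR R) R id (mem_set midR).
pose G r := fine (P `]-oo, r]%classic).
have GE r : (G r)%:E = P `]-oo, r]%classic by rewrite fineK// fin_num_measure.
have G0 r : 0 <= G r by rewrite fine_ge0.
have G1 r : G r <= 1 by rewrite -lee_fin GE probability_le1.
have Gnd : {homo G : r s / r <= s}.
  by move=> r s rs; rewrite -lee_fin !GE le_measure ?inE//; exact: subitvPr.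
have Ge t : t < 1 -> exists r, t < G r.
  move=> t1; have : \forall r \near +oo, t < G r.
    by apply: cvgr_gt t1; exact: fine_cvg (cvg_cdfy1 X).
  move=> [M [_ /(_ (M + 1))]] h; exists (M + 1).
  by apply: h; rewrite ltrDl.
have Gl t : 0 < t -> exists r, G r < t.
  move=> t0; have : \forall r \near -oo, G r < t.
    by apply: cvgr_lt t0; exact: fine_cvg (cvg_cdfNy0 X).
  move=> [M [_ /(_ (M - 1))]] h; exists (M - 1).
  by apply: h; rewrite gtrDl oppr_lt0.
(* Right continuity of [G] leaves room above r; this is what makes the inequality r < [Q0 t]
   strict. *)
have Gr t r : G r < t -> exists2 s, r < s & G s < t.
  move=> rt; have h : \forall s \near r^'+, G s < t.
    apply: cvgr_lt rt; apply: (@fine_cvg _ _ _ _ (cdf X)); rewrite GE.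
    exact: (@cdf_right_continuous _ _ _ _ X r).
  by near r^'+ => s; exists s => //; near: s.
pose S t := [set r | t <= G r].
pose Q0 t := inf (S t).
have Q0P t r : 0 < t < 1 -> (r < Q0 t) = (G r < t).
  move=> /andP[t0 t1].
  have Sn : S t !=set0 by have [s /ltW ts] := Ge _ t1; exists s.
  have Slb s : G s < t -> lbound (S t) s.
    move=> st u /= tu; rewrite leNgt; apply/negP => /ltW/Gnd us.
    by have := lt_le_trans st (le_trans tu us); rewrite ltxx.
  have hS : has_inf (S t) by split => //; have [s /Slb] := Gl _ t0; exists s.
  apply/idP/idP => [rQ|/Gr[s rs st]]; last first.
    by apply: lt_le_trans rs _; apply: lb_le_inf => //; exact: Slb.
  rewrite ltNge; apply/negP => tr.
  have : Q0 t <= r by apply: ge_inf => //; case: hS.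
  by rewrite leNgt rQ.
(* At t = 0 the set [S t] is the whole line and has no infimum. The value 0 put there produces the
   singleton in [QP], which is Lebesgue-null. *)
pose Q (t : R) : R := if (0 < t) && (t < 1) then Q0 t else 0.
have QP r : `[0, 1[ `&` Q @^-1` `]r, +oo[ =
    (`]0, 1[ `&` `]G r, +oo[) `|` (if r < 0 then [set 0] else set0) :> set R.
  have Q00 : Q 0 = 0 by rewrite /Q ltxx.
  apply/seteqP; split => t /=; rewrite !in_itv /= !andbT.
    move=> [/andP[]]; rewrite le_eqVlt => /predU1P[<- _|t0 t1].
      by rewrite Q00 => ->; right.
    by rewrite /Q t0 t1 /= Q0P ?t0//; left.
  case=> [[/andP[t0 t1]] rt|].
    by rewrite /Q t0 t1 (ltW t0) /= Q0P ?t0.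
  by case: ifPn => // r0 ->; rewrite Q00 lexx ltr01.
have mQP r : measurable (`]0, 1[ `&` `]G r, +oo[ : set (measurableTypeR R)).
  exact: measurableI.
have mr0 (r : R) : measurable ((if r < 0 then [set 0] else set0) : set (measurableTypeR R)).
  by case: ifP.
have mQ : measurable_fun (`[0, 1[%classic : set (measurableTypeR R)) Q.
  apply: (measurability _ (RGenOInfty.measurableE R)) => _ [_ [r ->] <-].
  by rewrite QP; exact: measurableU.
pose Q' : R -> R := Q \_ `[0, 1[ .
have mQ' : @measurable_fun _ _ (measurableTypeR R) (measurableTypeR R) setT Q'.
  by apply/(measurable_restrictT _ _).1.
exists Q'; split => // A mA.
have Q'E (B : set R) : `[0, 1[ `&` Q' @^-1` B = `[0, 1[ `&` Q @^-1` B.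
  by apply/seteqP; split => t [It]; rewrite /= /Q' patchE mem_set.
pose PQ : probability (measurableTypeR R) R := distribution uniform01
  (@mfun_Sub _ _ (measurableTypeR R) (measurableTypeR R) Q' (mem_set mQ')).
have PQE (B : set (measurableTypeR R)) : PQ B = lebesgue_measure (`[0, 1[%classic `&` Q @^-1` B).
  by rewrite -Q'E setIC.
rewrite Q'E -PQE; apply: probability_R_ext mA => r.
rewrite PQE QP measureU//; last first.
  apply/seteqP; split => // t [[/= + _]]; rewrite in_itv /= => /andP[t0 _].
  by case: ifP => // _ t00; move: t0; rewrite t00 ltxx.
rewrite [X in (_ + X)%E](_ : _ = 0%E); last first.
  by case: ifP => _; [exact: lebesgue_measure_set1|exact: measure0].
have -> : `]0, 1[ `&` `]G r, +oo[ = `]G r, 1[%classic :> set R.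
  apply/seteqP; split => t /=; rewrite !in_itv /= andbT; first by move=> [/andP[_ ->] ->].
  by move=> /andP[rt ->]; rewrite rt (le_lt_trans (G0 r)).
rewrite adde0 [LHS](lebesgue_measure_itv `]G r, 1[%R) /= lte_fin.
have -> : P `]r, +oo[%classic = (1 - P `]-oo, r]%classic)%E.
  by rewrite -probability_setC//; congr (P _); rewrite setCitvl.
rewrite -GE; case: ltP => // G1r; congr (_%:E).
by apply/eqP; rewrite eq_sym subr_eq0 eq_le G1r G1.
Unshelve. all: by end_near. Qed.
End quantile.

(** * Borel codes of points of a separable complete metric space *)

Section separable_metric.
Context {R : realType}.

Lemma exists_invS_lt (e : R) : 0 < e -> exists k, k.+1%:R^-1 < e.
Proof.
move=> e0; exists (Num.truncn e^-1).
by rewrite -[ltRHS]invrK ltf_pV2 ?posrE ?invr_gt0//; exact: truncnS_gt.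
Qed.

Lemma separable_dense_seq (X : completeMetricType R) : separable X ->
  exists s : nat -> X, forall x (e : R), 0 < e -> exists n, mdist (s n) x < e.
Proof.
move=> [D /countable_injP[g ginj] dD].
(* The sequence inverts the injection of D into the naturals; indices that are not hit receive the
   default [point]. *)
exists (fun n => xget point [set x | D x /\ g x = n]) => x e e0.
have [y [xy Dy]] : ball x e `&` D !=set0.
  apply: dD; last exact: open_ball_metric.
  by exists x; exact: ballxx.
exists (g y); case: xgetP => [z _ [Dz gz]|/(_ y)[]//].
rewrite (ginj _ _ _ _ gz) ?inE// metric_sym.
by move: xy; rewrite ballEmdist.
Qed.

Lemma measurable_fst_borel (X Y : completeMetricType R) :
  measurable_fun [set: borel (X * Y)%type] (fst : borel (X * Y)%type -> borel X).
Proof.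
apply: (@measurability _ _ (borel (X * Y)%type) (borel X) _ _ (@open X)) => // _ [W oW <-].
rewrite setTI; apply: sub_sigma_algebra.
by apply: open_comp => // z _; exact: cvg_fst.
Qed.

Lemma measurable_snd_borel (X Y : completeMetricType R) :
  measurable_fun [set: borel (X * Y)%type] (snd : borel (X * Y)%type -> borel Y).
Proof.
apply: (@measurability _ _ (borel (X * Y)%type) (borel Y) _ _ (@open Y)) => // _ [W oW <-].
rewrite setTI; apply: sub_sigma_algebra.
by apply: open_comp => // z _; exact: cvg_snd.
Qed.

(** By separability an open set of the product is a countable union of products of balls, with
    centres in the dense sequences and radii 1/(k+1). *)
Lemma measurable_pair_borel (X Y : completeMetricType R) d (T : measurableType d)
    (f : T -> borel X) (g : T -> borel Y) :
  separable X -> separable Y ->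
  measurable_fun setT f -> measurable_fun setT g ->
  measurable_fun setT (fun t => (f t, g t) : borel (X * Y)%type).
Proof.
move=> /separable_dense_seq[s hs] /separable_dense_seq[s' hs'] mf mg.
apply: (@measurability _ _ T (borel (X * Y)%type) setT _ (@open (X * Y)%type)) => //.
move=> _ [W oW <-].
pose P i j k := ball (s i) k.+1%:R^-1 `*` ball (s' j) k.+1%:R^-1 `<=` W.
pose A i j k := f @^-1` ball (s i) k.+1%:R^-1 `&` g @^-1` ball (s' j) k.+1%:R^-1.
rewrite [X in measurable X](_ : _ =
    \bigcup_i \bigcup_j \bigcup_(k in [set k | P i j k]) A i j k); last first.
  apply/seteqP; split => t.
    move=> [_ Wt]; have : nbhs (f t, g t) W by exact: open_nbhs_nbhs.
    move=> /nbhs_ballP[e /= e0 eW].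
    have e2 : 0 < e / 2 by rewrite divr_gt0.
    have [k ke] := exists_invS_lt e2.
    have k0 : (0 : R) < k.+1%:R^-1 by rewrite invr_gt0.
    have [i si] := hs (f t) _ k0; have [j sj] := hs' (g t) _ k0.
    exists i => //; exists j => //; exists k; last by split; rewrite /= ballEmdist.
    move=> [x y] /= [xi yj]; apply: eW; rewrite (splitr e).
    split => /=.
      apply: (@ball_triangle _ _ (s i)).
        by apply: (le_ball (ltW ke)); apply: ball_sym; rewrite ballEmdist.
      exact: le_ball (ltW ke) _ xi.
    apply: (@ball_triangle _ _ (s' j)).
      by apply: (le_ball (ltW ke)); apply: ball_sym; rewrite ballEmdist.
    exact: le_ball (ltW ke) _ yj.
  by move=> [i _ [j _ [k Pk [fi gj]]]]; split => //; exact: Pk.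
apply: bigcupT_measurable => i; apply: bigcupT_measurable => j.
apply: bigcup_measurable => k _; apply: measurableI.
  rewrite -[X in measurable X]setTI; apply: mf => //; apply: open_borel.
  exact: open_ball_metric.
rewrite -[X in measurable X]setTI; apply: mg => //; apply: open_borel.
exact: open_ball_metric.
Qed.

Lemma measurable_mdist (X : completeMetricType R) :
  measurable_fun [set: borel (X * X)%type] (fun z => mdist z.1 z.2).
Proof.
apply: (measurability _ (RGenInftyO.measurableE R)) => _ [_ [c ->] <-].
rewrite setTI; apply: sub_sigma_algebra.
rewrite openE => -[x y] /=; rewrite in_itv /= => xyc.
have e0 : 0 < (c - mdist x y) / 2 by rewrite divr_gt0// subr_gt0.
apply/nbhs_ballP; exists ((c - mdist x y) / 2) => //= -[x' y'] [/=].
rewrite !ballEmdist /= in_itv /= => xx' yy'.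
have := metric_triangle x' x y'; have := metric_triangle x y y'.
rewrite (metric_sym x' x); lra.
Qed.

Lemma measurable_min_mdist (X : completeMetricType R) :
  measurable_fun [set: borel (X * X)%type] (fun z => Num.min (mdist z.1 z.2) 1).
Proof. by apply: measurable_minr => //; exact: measurable_mdist. Qed.

(** * Measurable recovery of a point from its ball code *)

Section decode.
Context {X : completeMetricType R} (s : nat -> X).
Hypothesis s_dense : forall x (e : R), 0 < e -> exists n, mdist (s n) x < e.

Definition ball_code (x : X) (n k : nat) : bool := mdist (s n) x < k.+1%:R^-1.

(* The limit of the coded balls exists as soon as these conditions, which involve
   countably many bits and are therefore measurable, hold. *)
Let valid (b : nat -> nat -> bool) :=
  (forall k, exists n, b n k) /\
  forall n k m l, b n k -> b m l -> mdist (s n) (s m) < k.+1%:R^-1 + l.+1%:R^-1.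

(** Closed balls are used, although [ball_code] is strict, so that the condition survives limits. *)
Let coded (b : nat -> nat -> bool) (x : X) := forall n k, b n k -> mdist (s n) x <= k.+1%:R^-1.

Let valid_code x : valid (ball_code x).
Proof.
split=> [k|n k m l]; first by apply: s_dense; rewrite invr_gt0.
rewrite /ball_code => nx mx; apply: le_lt_trans (metric_triangle _ x _) _.
by apply: ltrD => //; rewrite metric_sym.
Qed.

Let coded_uniq b x y : valid b -> coded b x -> coded b y -> x = y.
Proof.
move=> [bn _] bx by_; apply: mdist_positivity; apply/eqP.
rewrite eq_le mdist_ge0 andbT; apply/ler_addgt0Pl => e e0; rewrite addr0.
have e2 : 0 < e / 2 by rewrite divr_gt0.
have [k ke] := exists_invS_lt e2; have [n /[dup] /bx nx /by_ ny] := bn k.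
have := metric_triangle x (s n) y; rewrite (metric_sym x (s n)).
by move: (k.+1%:R^-1) nx ny ke => r; lra.
Qed.

(** Choosing one coded ball of each radius gives centres that are Cauchy by the pairwise conditions
    in [valid]. Their limit exists by completeness and lies in every coded closed ball. *)
Let coded_ex b : valid b -> exists x, coded b x.
Proof.
move=> [bn bb]; have [n_ hn] := choice bn.
pose u k := s (n_ k).
have uu k l : mdist (u k) (u l) < k.+1%:R^-1 + l.+1%:R^-1 by exact: bb.
have invS_le (k l : nat) : (k <= l)%N -> (l.+1%:R^-1 : R) <= k.+1%:R^-1.
  by move=> kl; rewrite lef_pV2 ?posrE// ler_nat.
have cu : cauchy (u @ \oo).
  apply: cauchy_exP => e e0.
  have e2 : 0 < e / 2 by rewrite divr_gt0.
  have [k ke] := exists_invS_lt e2; exists (u k).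
  exists k => // l /= /invS_le kl; rewrite ballEmdist /=.
  by move: (k.+1%:R^-1) (l.+1%:R^-1) kl ke (uu k l) => r r' *; lra.
have ul : u @ \oo --> lim (u @ \oo) by exact: cauchy_cvg.
exists (lim (u @ \oo)) => n k nk; apply/ler_addgt0Pl => e e0.
have e2 : 0 < e / 2 by rewrite divr_gt0.
have [l le2] := exists_invS_lt e2.
have [N _ hN] : \forall m \near \oo, ball (lim (u @ \oo)) (e / 2) (u m).
  by apply: ul; exact: nbhsx_ballx.
pose m := maxn N l.
have := hN m (leq_maxl _ _); rewrite ballEmdist /= metric_sym.
have := invS_le l m (leq_maxr _ _).
have := bb n k (n_ m) m nk (hn m); rewrite -/(u m).
have := metric_triangle (s n) (u m) (lim (u @ \oo)).
by move: (k.+1%:R^-1) (l.+1%:R^-1) (m.+1%:R^-1) le2 => r r' r'' *; lra.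
Qed.

(** On the measurable set of valid codes, the decoded point lies in an open W iff some bit is set
    whose closed ball is contained in W. The preimage of W is thus a countable union of bit
    events. *)
Lemma measurable_decode d (T : measurableType d) (b : T -> nat -> nat -> bool) :
  (forall n k, measurable_fun setT (fun t => b t n k)) ->
  exists g : T -> borel X, measurable_fun setT g /\
    forall t x, b t = ball_code x -> g t = x.
Proof.
move=> mb.
pose V := [set t | valid (b t)].
pose g t := xget point (coded (b t)).
have gP t : V t -> coded (b t) (g t).
  by move=> /coded_ex[x bx]; rewrite /g; case: xgetP => // /(_ x)[].
have mbT n k : measurable [set t | b t n k].
  by rewrite -[X in measurable X]setTI; exact: (mb n k measurableT [set true]).
have mV : measurable V.
  rewrite [X in measurable X](_ : _ = (\bigcap_k \bigcup_n [set t | b t n k]) `&`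
    \bigcap_n \bigcap_k \bigcap_m \bigcap_l (~` ([set t | b t n k] `&` [set t | b t m l]) `|`
      [set t | mdist (s n) (s m) < k.+1%:R^-1 + l.+1%:R^-1])); last first.
    apply/seteqP; split => t [t1 t2]; split.
    - by move=> k _; have [n nk] := t1 k; exists n.
    - move=> n _ k _ m _ l _ /=; have := t2 n k m l.
      by case: (b t n k) => [|_]; [case: (b t m l) => [h|_]; [right; exact: h|left; case]|left; case].
    - by move=> k; have [n _ nk] := t1 k I; exists n.
    - by move=> n k m l nk ml; case: (t2 n I k I m I l I) => // -[].
  apply: measurableI; first by apply: bigcapT_measurable => k; exact: bigcupT_measurable.
  do 4 (apply: bigcapT_measurable => ?); apply: measurableU.
    by apply: measurableC; exact: measurableI.
  (* The remaining event does not depend on t: it is everything or empty. *)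
  case: (_ < _).
    by rewrite (_ : mkset _ = setT)//; apply/seteqP; split.
  by rewrite (_ : mkset _ = set0)//; apply/seteqP; split.
exists (g \_ V); split; last first.
  move=> t x tx; have Vt : V t by rewrite /V /= tx; exact: valid_code.
  rewrite patchE mem_set//; apply: (coded_uniq Vt); first exact: gP.
  by rewrite tx => n k /ltW.
apply/(measurable_restrictT _ mV).1.
apply: (@measurability _ _ T (borel X) V _ (@open X)) => // _ [W oW <-].
pose P n k := [set x | mdist (s n) x <= k.+1%:R^-1] `<=` W.
rewrite [X in measurable X](_ : _ = V `&`
    \bigcup_n \bigcup_(k in [set k | P n k]) [set t | b t n k]).
  apply: measurableI => //; apply: bigcupT_measurable => n.
  by apply: bigcup_measurable => k _; exact: mbT.
apply/seteqP; split => t [Vt].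
  move=> Wt; split => //.
  have /nbhs_ballP[e /= e0 eW] : nbhs (g t) W by exact: open_nbhs_nbhs.
  have e2 : 0 < e / 2 by rewrite divr_gt0.
  have [k ke] := exists_invS_lt e2; have [n nk] := Vt.1 k.
  exists n => //; exists k => // y /= ny; apply: eW; rewrite ballEmdist /=.
  have := gP _ Vt _ _ nk; have := metric_triangle (g t) (s n) y.
  rewrite (metric_sym (g t) (s n)).
  by move: (k.+1%:R^-1) ny ke => r; lra.
by move=> [n _ [k Pk nk]]; split => //; apply: Pk; exact: gP.
Qed.

End decode.

Lemma measurable_ball_code (X : completeMetricType R) d (T : measurableType d)
    (f : T -> borel X) (s : nat -> X) n k :
  measurable_fun setT f -> measurable_fun setT (fun t => ball_code s (f t) n k).
Proof.
move=> mf; apply: (measurable_fun_bool true).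
rewrite [X in measurable X](_ : _ = setT `&` f @^-1` ball (s n) k.+1%:R^-1).
  by apply: mf => //; apply: open_borel; exact: open_ball_metric.
by rewrite ballEmdist.
Qed.

Lemma coupling_parameter (X Y : completeMetricType R)
    (p : probability (borel (X * Y)%type) R) : separable X -> separable Y ->
  exists (q1 : measurableTypeR R -> borel X) (q2 : measurableTypeR R -> borel Y),
    [/\ measurable_fun setT q1, measurable_fun setT q2 &
    forall B : set (borel (X * Y)%type), measurable B ->
      uniform01 ((fun t => (q1 t, q2 t)) @^-1` B) = p B].
Proof.
move=> sX sY.
have [s1 h1] := separable_dense_seq sX; have [s2 h2] := separable_dense_seq sY.
(* Both codes are merged into one sequence: the Boolean flag in the pickled index tells which
   coordinate the bit describes. Indices that decode to nothing get a default triple. *)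
pose c (z : X * Y) (j : nat) : bool :=
  let w := odflt (true, (0%N, 0%N)) (unpickle j) in
  if w.1 then ball_code s1 z.1 w.2.1 w.2.2 else ball_code s2 z.2 w.2.1 w.2.2.
have mc j : measurable_fun [set: borel (X * Y)%type] (c ^~ j).
  rewrite /c; case: (odflt _ _) => [[] [n k]] /=; apply: measurable_ball_code.
    exact: measurable_fst_borel.
  exact: measurable_snd_borel.
pose F (z : borel (X * Y)%type) : measurableTypeR R := ternary (c z).
have mF : @measurable_fun _ _ (borel (X * Y)%type) (measurableTypeR R) setT F.
  exact: measurable_ternary.
pose P : probability (measurableTypeR R) R := distribution p
  (@mfun_Sub _ _ (borel (X * Y)%type) (measurableTypeR R) F (mem_set mF)).
have [Q [mQ QP]] := quantile_ex P.
have dP (i : bool) : forall n k : nat, measurable_fun [set: measurableTypeR R]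
    (fun r => ternary_digit (pickle (i, (n, k))) r).
  by move=> n k; exact: measurable_ternary_digit.
have [g1 [mg1 g1P]] := measurable_decode h1 (dP true).
have [g2 [mg2 g2P]] := measurable_decode h2 (dP false).
have g1F z : g1 (F z) = z.1.
  apply: g1P; apply/funext => n; apply/funext => k.
  by rewrite /F ternaryK /c pickleK.
have g2F z : g2 (F z) = z.2.
  apply: g2P; apply/funext => n; apply/funext => k.
  by rewrite /F ternaryK /c pickleK.
have mg := measurable_pair_borel sX sY mg1 mg2.
exists (g1 \o Q), (g2 \o Q); split; [exact: measurableT_comp|exact: measurableT_comp|].
move=> B mB; rewrite uniform01E.
have mgB : measurable ((fun r => (g1 r, g2 r)) @^-1` B).
  by rewrite -[X in measurable X]setTI; exact: mg.
(* The law of [Q] is that of the code [F] under p, and decoding after [F] is the identity on pairs;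
   so the decoded pair has law p. *)
rewrite [LHS](QP _ mgB) -[LHS]/(p (F @^-1` ((fun r => (g1 r, g2 r)) @^-1` B))).
by congr (p _); apply/seteqP; split => -[x y] /=; rewrite g1F g2F.
Qed.

End separable_metric.

(** * The lower bound *)

Section probability_bounds.
Context d (T : measurableType d) {R : realType} (p : probability T R).
Variables (f : T -> R) (A : set T) (c : R).
Hypotheses (mf : measurable_fun setT f) (f0 : forall z, 0 <= f z).
Hypotheses (mA : measurable A) (c0 : 0 <= c).
Local Open Scope ereal_scope.

Let mfE (D : set T) : measurable_fun D (EFin \o f).
Proof. by apply/measurable_EFinP; exact: measurable_funTS. Qed.

Lemma ge_integral_on : (forall z, A z -> (c <= f z)%R) ->
  c%:E * p A <= \int[p]_z (f z)%:E.
Proof.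
move=> cf; rewrite -integral_cst//.
apply: (@le_trans _ _ (\int[p]_(z in A) (f z)%:E)).
  by apply: ge0_le_integral => //; exact: mfE.
by apply: ge0_subset_integral => // z _; rewrite lee_fin.
Qed.

Lemma le_integral_on : (forall z, (f z <= 1)%R) -> (forall z, A z -> (f z <= c)%R) ->
  \int[p]_z (f z)%:E <= c%:E + p (~` A).
Proof.
move=> f1 fc; have mCA := measurableC mA; rewrite -(setUv A) ge0_integral_setU//; last 2 first.
- by move=> z _; rewrite lee_fin.
- by rewrite disj_set2E setICr.
apply: leeD.
  apply: (@le_trans _ _ (\int[p]_(z in A) (cst c%:E) z)).
    by apply: ge0_le_integral => // z; rewrite lee_fin.
  by rewrite integral_cst// -[leRHS]mule1 lee_wpmul2l// ?probability_le1.
apply: (@le_trans _ _ (\int[p]_(z in ~` A) (cst 1) z)).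
  by apply: ge0_le_integral; rewrite /= => // z _; rewrite lee_fin.
by rewrite integral_cst ?mul1e.
Qed.

End probability_bounds.

Section box_lower_bound.
Context {R : realType}.
Local Open Scope ereal_scope.

Lemma box_dist_ge0 (d1 d2 : R -> R -> R) : 0 <= box_dist d1 d2.
Proof.
by apply: le_ereal_inf_tmp => _ [e [/andP[e0 _] _] <-]; rewrite lee_fin.
Qed.

Lemma box_mm_ge0 (X Y : mmspace R) : 0 <= box_mm X Y.
Proof. by apply: le_ereal_inf_tmp => _ [q1 [q2 [_ _ ->]]]; exact: box_dist_ge0. Qed.

Lemma is_parameterP (X : completeMetricType R) (m : probability (borel X) R)
    (q : measurableTypeR R -> borel X) :
  measurable_fun setT q ->
  (forall B, measurable B -> uniform01 (q @^-1` B) = m B) -> is_parameter m q.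
Proof.
by move=> mq qm; split; [exact: measurable_funTS|move=> B /qm <-; rewrite uniform01E].
Qed.

Section coupling.
Context (U : urysohn R) (mu nu : probability (borel U) R).
Variable (p : probability (borel (U * U)%type) R).
Hypothesis cp : is_coupling mu nu p.

Let far (e : R) : set (U * U) := [set z | (e < mdist z.1 z.2)%R].

Let measurable_far e : measurable (far e : set (borel (U * U)%type)).
Proof.
rewrite [X in measurable X](_ : _ = setT `&` (fun z => mdist z.1 z.2) @^-1` `]e, +oo[).
  exact: measurable_mdist.
by rewrite setTI; apply/seteqP; split => z /=; rewrite in_itv /= andbT.
Qed.

(** The witness set is where the parameters realising p are within e / 2 of each other. Replacing
    both endpoints of a distance then costs e / 2 twice. *)
Lemma box_mm_le_far (e : R) : (0 <= e <= 1)%R -> p (far (e / 2)) <= e%:E ->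
  box_mm (MMSpace (ury_separable U) mu) (MMSpace (ury_separable U) nu) <= e%:E.
Proof.
move=> e01 pe.
have [q1 [q2 [mq1 mq2 qp]]] := coupling_parameter p (ury_separable U) (ury_separable U).
have [p1 p2] := cp.
apply: (@le_trans _ _ (box_dist (pullback (q1 : R -> U)) (pullback (q2 : R -> U)))).
  apply: ereal_inf_lbound; exists q1, q2; split => //.
    apply: is_parameterP => // B mB; rewrite -p1//.
    rewrite -qp; first by congr (uniform01 _); apply/seteqP; split => t //= [].
    rewrite [X in measurable X](_ : _ = setT `&` fst @^-1` B); first exact: measurable_fst_borel.
    by apply/seteqP; split=> z // [].
  apply: is_parameterP => // B mB; rewrite -p2//.
  rewrite -qp; first by congr (uniform01 _); apply/seteqP; split => t //= [].
  rewrite [X in measurable X](_ : _ = setT `&` snd @^-1` B); first exact: measurable_snd_borel.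
  by apply/seteqP; split=> z // [].
apply: ereal_inf_lbound; exists e => //; split => //.
pose J := (fun t => (q1 t, q2 t)) @^-1` (~` far (e / 2)).
have mJ : measurable (J : set (measurableTypeR R)).
  rewrite -[X in measurable X]setTI.
  apply: (measurable_pair_borel (ury_separable U) (ury_separable U) mq1 mq2) => //.
  by apply: measurableC; exact: measurable_far.
exists (`[0%R, 1%R[%classic `&` J); split.
- exact: measurableI.
- exact: subIsetl.
- rewrite -[leRHS]uniform01E qp; last by apply: measurableC; exact: measurable_far.
  rewrite probability_setC; last exact: measurable_far.
  by rewrite EFinB leeB.
- move=> t s [_ Jt] [_ Js]; rewrite /pullback.
  have : (mdist (q1 t) (q2 t) <= e / 2)%R by rewrite leNgt; apply/negP.
  have : (mdist (q1 s) (q2 s) <= e / 2)%R by rewrite leNgt; apply/negP.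
  have := metric_triangle (q1 t) (q2 t) (q1 s).
  have := metric_triangle (q2 t) (q2 s) (q1 s).
  have := metric_triangle (q2 t) (q1 t) (q2 s).
  have := metric_triangle (q1 t) (q1 s) (q2 s).
  rewrite (metric_sym (q2 t : U) (q1 t)) (metric_sym (q2 s : U) (q1 s)) ler_norml.
  by move=> *; apply/andP; split; lra.
Qed.

(** By contradiction: if the cost r of p were below b^2 / 2, with b the box distance, Markov's
    inequality would give some e < b to which [box_mm_le_far] applies. *)
Lemma box_mm_coupling_le :
  (2^-1)%:E * box_mm (MMSpace (ury_separable U) mu) (MMSpace (ury_separable U) nu) ^+ 2 <=
  \int[p]_z (Num.min (mdist z.1 z.2) 1%R)%:E.
Proof.
set B := box_mm _ _.
have B0 : 0 <= B by exact: box_mm_ge0.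
have B1 : B <= 1.
  (* For e = 1 the condition on [far] is trivial; the resulting bound also makes the box distance
     finite. *)
  apply: box_mm_le_far; first by rewrite ler01 lexx.
  exact: probability_le1.
have BE : B = (fine B)%:E by rewrite fineK// ge0_fin_numE// (le_lt_trans B1)// ltry.
move: B0 B1; rewrite BE; move: (fine B) BE => b BE; rewrite !lee_fin => b0 b1.
rewrite -EFin_expe -EFinM leNgt; apply/negP.
set w := (X in X < _) => wb.
have w0 : 0 <= w by apply: integral_ge0 => z _; rewrite lee_fin le_min mdist_ge0 ler01.
have wE : w = (fine w)%:E by rewrite fineK// ge0_fin_numE// (lt_trans wb)// ltry.
move: wb w0; rewrite wE !lte_fin !lee_fin; set r := fine w => rb r0.
have bpos : (0 < b)%R.
  rewrite lt_neqAle b0 andbT; apply/eqP => b00; move: rb.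
  by rewrite -b00 expr0n mulr0 ltNge r0.
(* The square root gives r <= e^2 / 2, as Markov requires; b / 2 keeps e positive when r = 0. As e <
   b <= 1, the truncation of the cost at 1 stays above e / 2. *)
pose e := Num.max (Num.sqrt (2 * r)%R) (b / 2)%R.
have eb : (e < b)%R.
  rewrite gt_max; apply/andP; split; last by lra.
  rewrite -(ger0_norm b0) -sqrtr_sqr ltr_sqrt ?exprn_gt0//; lra.
have e0 : (0 < e)%R by rewrite lt_max (divr_gt0 bpos)// orbT.
have re : (r <= e * (e / 2))%R.
  rewrite mulrA -expr2 ler_pdivlMr// mulrC.
  rewrite -[leLHS]sqr_sqrtr ?mulr_ge0// ler_pXn2r// ?nnegrE ?sqrtr_ge0 ?(ltW e0)//.
  by rewrite le_max lexx.
have e2 : (0 < e / 2)%R by rewrite divr_gt0.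
suff : B <= e%:E by rewrite BE lee_fin leNgt eb.
apply: box_mm_le_far; first by rewrite (ltW e0) (le_trans (ltW eb)).
have pr : (e / 2)%:E * p (far (e / 2)) <= r%:E.
  rewrite -wE; apply: ge_integral_on => //.
  - exact: measurable_min_mdist.
  - by move=> z; rewrite le_min mdist_ge0 ler01.
  - exact: ltW.
  - move=> z /= zf; rewrite le_min (ltW zf); lra.
have pE : p (far (e / 2)) = (fine (p (far (e / 2))))%:E by rewrite fineK// fin_num_measure.
move: pr; rewrite pE -EFinM !lee_fin => /le_trans/(_ re).
by rewrite [leRHS]mulrC ler_pM2l.
Qed.

End coupling.
End box_lower_bound.

(** * Gluing two metric spaces *)

Section glued_metric.
Context {R : realType}.

Record is_distance {T : Type} (D : T -> T -> R) : Prop := IsDistance {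
  distance0 : forall a, D a a = 0 ;
  distance_pos : forall a b, D a b = 0 -> a = b ;
  distance_sym : forall a b, D a b = D b a ;
  distance_triangle : forall b a c, D a c <= D a b + D b c }.

(** A copy of T carrying the proof as a parameter, from which the metric instance is inferred. *)
Definition distance_space (T : choiceType) (D : T -> T -> R)
  of is_distance D : Type := T.

Section distance_space.
Variables (T : choiceType) (D : T -> T -> R) (dD : is_distance D).

HB.instance Definition _ := Choice.copy (distance_space dD) T.
HB.instance Definition _ := isMetric.Build R (distance_space dD)
  (distance0 dD) (distance_pos dD) (distance_sym dD) (distance_triangle dD).

End distance_space.

Variables (X Y : metricType R) (J : Type) (I : set J) (q1 : J -> X) (q2 : J -> Y).
Variable c : R.
Hypotheses (c0 : 0 < c) (I0 : I !=set0).
Hypothesis q12 : forall t s, I t -> I s ->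
  `|mdist (q1 t) (q1 s) - mdist (q2 t) (q2 s)| <= 2 * c.

(** Lengths of paths from x to y over a bridge of length c that joins q1 t to q2 t. *)
Let cross_set x y := [set mdist x (q1 t) + mdist (q2 t) y + c | t in I].

Let cross x y := inf (cross_set x y).

Let cross_le x y t : I t -> cross x y <= mdist x (q1 t) + mdist (q2 t) y + c.
Proof.
move=> It; apply: ge_inf; last by exists t.
by exists 0 => _ [s _ <-]; rewrite !addr_ge0 ?mdist_ge0 ?ltW.
Qed.

Let le_cross a x y :
  (forall t, I t -> a <= mdist x (q1 t) + mdist (q2 t) y + c) -> a <= cross x y.
Proof.
move=> h; apply: lb_le_inf; last by move=> _ [t It <-]; exact: h.
by have [t It] := I0; exists (mdist x (q1 t) + mdist (q2 t) y + c), t.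
Qed.

Let cross_ge x y : c <= cross x y.
Proof. by apply: le_cross => t _; rewrite lerDr addr_ge0 ?mdist_ge0. Qed.

Let cross_triangle_l x x' y : cross x y <= mdist x x' + cross x' y.
Proof.
rewrite -lerBlDl; apply: le_cross => t It.
have := cross_le x y It; have := metric_triangle x x' (q1 t); lra.
Qed.

Let cross_triangle_r x y y' : cross x y <= cross x y' + mdist y' y.
Proof.
rewrite -lerBlDr; apply: le_cross => t It.
have := cross_le x y It; have := metric_triangle (q2 t) y' y; lra.
Qed.

(** A path from x to x' through y crosses two bridges, at t and s. Their total length 2 c pays for
    the difference between the distances of q1 t, q1 s and of q2 t, q2 s. *)
Let mdist_cross_l x x' y : mdist x x' <= cross x y + cross x' y.
Proof.
rewrite -lerBlDr; apply: le_cross => t It.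
rewrite lerBlDr -lerBlDl; apply: le_cross => s Is.
have := q12 It Is; rewrite ler_norml => /andP[_].
have := metric_triangle x (q1 t) x'; have := metric_triangle (q1 t) (q1 s) x'.
have := metric_triangle (q2 t) y (q2 s).
rewrite (metric_sym (q1 s) x') (metric_sym y (q2 s)); lra.
Qed.

Let mdist_cross_r x y y' : mdist y y' <= cross x y + cross x y'.
Proof.
rewrite -lerBlDr; apply: le_cross => t It.
rewrite lerBlDr -lerBlDl; apply: le_cross => s Is.
have := q12 It Is; rewrite ler_norml => /andP[+ _].
have := metric_triangle y (q2 t) y'; have := metric_triangle (q2 t) (q2 s) y'.
have := metric_triangle (q1 t) x (q1 s).
rewrite (metric_sym y (q2 t)) (metric_sym (q1 t) x); lra.
Qed.

Let glue (a b : X + Y) : R :=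
  match a, b with
  | inl x, inl x' => mdist x x'
  | inr y, inr y' => mdist y y'
  | inl x, inr y => cross x y
  | inr y, inl x => cross x y
  end.

Let glue_distance : is_distance glue.
Proof.
(* Positivity of c separates the two summands, so the glued function is a genuine distance on the
   disjoint union. *)
have cpos x y : 0 < cross x y by exact: lt_le_trans c0 (cross_ge x y).
split.
- by case=> x /=; exact: mdistxx.
- case=> [x|y] [x'|y'] /=; try (by move=> /mdist_positivity ->).
  + by move=> h; have := cpos x y'; rewrite h ltxx.
  + by move=> h; have := cpos x' y; rewrite h ltxx.
- by case=> [x|y] [x'|y'] //=; exact: metric_sym.
- case=> [b|b] [a|a] [a'|a'] /=; try exact: metric_triangle.
  + exact: cross_triangle_l.
  + by rewrite addrC metric_sym; apply: cross_triangle_l.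
  + exact: mdist_cross_r.
  + exact: mdist_cross_l.
  + exact: cross_triangle_r.
  + by rewrite addrC metric_sym; exact: cross_triangle_r.
Qed.

(** The bridge at t bounds the distance between the images of q1 t and q2 t. Separability, which
    universality of U asks for, comes from the union of the two dense sets. *)
Lemma glued_metric : separable X -> separable Y ->
  exists (M : metricType R) (i : X -> M) (j : Y -> M),
    [/\ Defs.isometry i, Defs.isometry j, separable M &
        forall t, I t -> mdist (i (q1 t)) (j (q2 t)) <= c].
Proof.
move=> [D cD dD] [E cE dE].
pose M : metricType R := distance_space glue_distance.
exists M, (inl : X -> M), (inr : Y -> M); split=> //; last first.
  by move=> t It; have := cross_le (q1 t) (q2 t) It; rewrite !mdistxx !add0r.
exists ((inl : X -> M) @` D `|` (inr : Y -> M) @` E).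
  rewrite -bigcup2E; apply: bigcup_countable => // k _; rewrite /bigcup2.
  by case: k => [|[|k]] //=; exact: sub_countable (card_image_le _ _) _.
move=> W [m Wm] oW; have /nbhs_ballP[r /= r0 rW] : nbhs m W by exact: open_nbhs_nbhs.
case: m Wm rW => [x|y] Wm rW.
  have [x' [xx' Dx']] : ball x r `&` D !=set0.
    by apply: dD; [exists x; exact: ballxx|exact: open_ball_metric].
  exists (inl x'); split; last by left; exists x'.
  by apply: rW; move: xx'; rewrite !ballEmdist.
have [y' [yy' Ey']] : ball y r `&` E !=set0.
  by apply: dE; [exists y; exact: ballxx|exact: open_ball_metric].
exists (inr y'); split; last by right; exists y'.
by apply: rW; move: yy'; rewrite !ballEmdist.
Qed.

End glued_metric.

(** * The upper bound *)

Section upper_bound.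
Context {R : realType}.

Lemma box_dist_sym (d1 d2 : R -> R -> R) : (box_dist d1 d2 <= box_dist d2 d1)%E.
Proof.
apply: ereal_inf_le_tmp => _ [e [e01 [I [mI I01 Ie Id]]] <-].
exists e => //; split => //; exists I; split => // t s It Is.
by rewrite distrC; exact: Id.
Qed.

Lemma box_mm_sym (X Y : mmspace R) : (box_mm X Y <= box_mm Y X)%E.
Proof.
apply: le_ereal_inf_tmp => _ [qY [qX [pY pX ->]]].
apply: (le_trans _ (box_dist_sym _ _)); apply: ereal_inf_lbound.
by exists qX, qY.
Qed.

(** Resetting the parameter to a constant off [0, 1[ makes it measurable on the whole line. *)
Lemma parameter_extension (X : completeMetricType R) (m : probability (borel X) R)
    (q : R -> X) : is_parameter m q ->
  exists q' : measurableTypeR R -> borel X, [/\ measurable_fun setT q',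
    forall B, measurable B -> uniform01 (q' @^-1` B) = m B &
    forall t, `[0, 1[%classic t -> q' t = q t].
Proof.
move=> [mq qm].
have qE t : `[0, 1[%classic t -> ((q : measurableTypeR R -> borel X) \_ `[0, 1[) t = q t.
  by move=> It; rewrite patchE mem_set.
exists ((q : measurableTypeR R -> borel X) \_ `[0, 1[); split => //.
  by apply/(measurable_restrictT _ _).1.
move=> B mB; rewrite uniform01E -qm//; congr (lebesgue_measure _).
by apply/seteqP; split=> t [It] /=; rewrite qE.
Qed.

(** * Transport bounds from nearby parameters *)

Section wasserstein_bound.
Context (U : urysohn R).

(** The coupling is the joint law of f and g; its cost is at most c where they are c-close and at
    most 1 elsewhere. *)
Lemma W_le (mu nu : probability (borel U) R) (f g : measurableTypeR R -> borel U)
    (G : set (measurableTypeR R)) (c : R) :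
  measurable_fun setT f -> measurable_fun setT g ->
  (forall B, measurable B -> uniform01 (f @^-1` B) = mu B) ->
  (forall B, measurable B -> uniform01 (g @^-1` B) = nu B) ->
  0 <= c -> measurable G -> (forall t, G t -> mdist (f t : U) (g t) <= c) ->
  (W mu nu <= c%:E + uniform01 (~` G))%E.
Proof.
move=> mf mg fmu gnu c0 mG Gc.
have mfg := measurable_pair_borel (ury_separable U) (ury_separable U) mf mg.
pose p : probability (borel (U * U)%type) R := distribution uniform01
  (@mfun_Sub _ _ (measurableTypeR R) (borel (U * U)%type) _ (mem_set mfg)).
pose A : set (U * U) := [set z | mdist z.1 z.2 <= c].
have mA : measurable (A : set (borel (U * U)%type)).
  rewrite [X in measurable X](_ : _ = setT `&` (fun z => mdist z.1 z.2) @^-1` `]-oo, c]).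
    exact: measurable_mdist.
  by rewrite setTI; apply/seteqP; split => z /=; rewrite in_itv.
apply: (@le_trans _ _ (\int[p]_z (Num.min (mdist z.1 z.2) 1)%:E)%E).
  apply: ereal_inf_lbound; exists p => //; split => B mB.
    by rewrite -fmu// -[LHS]/(uniform01 _); congr (uniform01 _);
      apply/seteqP; split => t //= [].
  by rewrite -gnu// -[LHS]/(uniform01 _); congr (uniform01 _);
    apply/seteqP; split => t //= [].
apply: (@le_trans _ _ (c%:E + p (~` A))%E).
  apply: le_integral_on => //.
  - exact: measurable_min_mdist.
  - by move=> z; rewrite le_min mdist_ge0 ler01.
  - by move=> z; rewrite ge_min lexx orbT.
  - by move=> z Az; rewrite ge_min Az.
apply: leeD => //; rewrite -[leLHS]/(uniform01 _); apply: le_measure; rewrite ?inE.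
- by rewrite -[X in measurable X]setTI; apply: (mfg) => //; exact: measurableC.
- exact: measurableC.
- by move=> t /= nA Gt; apply: nA; exact: Gc.
Qed.

(** The finite unions of balls increase to the whole space, so their measures tend to 1. *)
Lemma inner_net (X : completeMetricType R) (m : probability (borel X) R)
    (s : nat -> X) (r e : R) :
  (forall x (e : R), 0 < e -> exists n, mdist (s n) x < e) -> 0 < r -> 0 < e ->
  exists N, (m (~` \bigcup_(n in `I_N) ball (s n) r) <= e%:E)%E.
Proof.
move=> hs r0 e0; pose A N := \bigcup_(n in `I_N) ball (s n) r.
have mA N : measurable (A N : set (borel X)).
  by apply: bigcup_measurable => n _; apply: open_borel; exact: open_ball_metric.
have AT : \bigcup_N A N = setT.
  rewrite -subTset => x _; have [n nx] := hs x _ r0.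
  by exists n.+1 => //; exists n => //=; rewrite ballEmdist.
have : m (A N) @[N --> \oo] --> m (\bigcup_N A N).
  apply: nondecreasing_cvg_mu => //; first exact: bigcupT_measurable.
  move=> N M NM; apply/subsetPset => x [n nN nx]; exists n => //.
  exact: leq_trans NM.
rewrite AT probability_setT => /fine_cvg; rewrite /= => mA1.
have [N _ hN] : \forall N \near \oo, 1 - e < fine (m (A N)).
  by apply: (cvgr_gt _ mA1); rewrite gtrBl.
exists N; rewrite -/(A N) probability_setC//.
have /= := hN N (leqnn N).
by rewrite -[m (A N)]fineK ?fin_num_measure// -EFinB lee_fin; lra.
Qed.

(** Both orders of the arguments are bounded, by the same pair of maps, since [W_H] fixes either the
    first or the second measure. *)
Lemma W_le_box (mu : probability (borel U) R) (Y : mmspace R)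
    (q1 : R -> U) (q2 : R -> Y) (e dl : R) (I : set (measurableTypeR R)) :
  is_parameter mu q1 -> is_parameter (mm_meas Y) q2 -> 0 <= e ->
  measurable I -> I `<=` `[0, 1[ -> ((1 - e)%:E <= lebesgue_measure I)%E ->
  (forall t s, I t -> I s -> `|pullback q1 t s - pullback q2 t s| <= e) ->
  0 < dl ->
  exists (g : Y -> U) (gi : Defs.isometry g),
    (W mu (image_meas gi (mm_meas Y)) <= (3 / 2 * e + dl)%:E)%E /\
    (W (image_meas gi (mm_meas Y)) mu <= (3 / 2 * e + dl)%:E)%E.
Proof.
move=> p1 p2 e0 mI I01 Ie Id dl0.
(* The final bound is (c + 2 r) + (e + r) = 3 e / 2 + 7 r / 2, and 7 r / 2 < dl. The r inside c
   keeps c positive when e = 0, as the gluing demands. *)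
pose r := dl / 4; have r0 : 0 < r by rewrite divr_gt0.
pose c := (e + r) / 2; have c0 : 0 < c by rewrite divr_gt0// ltr_wpDl.
have [s hs] := separable_dense_seq (ury_separable U).
have [N muN] := inner_net mu hs r0 r0.
set A := \bigcup_(n in `I_N) ball (s n) r in muN.
(* The gluing needs a nonempty set; one point always satisfies the constraint. *)
have [I' [I'0 I'd II']] : exists I' : set R, [/\ I' !=set0,
    forall t u, I' t -> I' u ->
      `|mdist (q1 t) (q1 u) - mdist (q2 t) (q2 u)| <= 2 * c & I `<=` I'].
  have [I0|/set0P/negP/negPn/eqP I0] := pselect (I !=set0).
    exists I; split => // t u It Iu; apply: le_trans (Id _ _ It Iu) _.
    by rewrite /c; lra.
  exists [set 0]; split; [by exists 0| |by rewrite I0].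
  by move=> t u -> ->; rewrite !mdistxx subrr normr0 mulr_ge0// ltW.
have [M [i [j [ii ji sM ijc]]]] :=
  glued_metric c0 I'0 I'd (ury_separable U) (@mm_separable _ Y).
have [h hi] := ury_universal U sM.
have [psi [psii [rho rhoK psiK] psiF]] :
    exists psi : U -> U, [/\ Defs.isometry psi, bijective psi &
      {in s @` `I_N, h \o i =1 psi}].
  apply: ury_homogeneous; first exact/finite_image/finite_II.
  by move=> x y _ _; rewrite /= hi ii.
have rhoi : Defs.isometry rho by move=> x y; rewrite -psii !psiK.
pose g := rho \o (h \o j).
have gi : Defs.isometry g by move=> x y; rewrite /g /= rhoi hi ji.
(* A point of [A] is within r of a centre fixed by [rho \o h \o i], so this map displaces it by less
   than 2 r; the bridge adds c. *)
have close t : I t -> A (q1 t) -> mdist (q1 t) (g (q2 t)) <= c + 2 * r.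
  move=> It [n nN]; rewrite ballEmdist /= => nt.
  have sn : rho (h (i (s n))) = s n.
    by rewrite -[RHS]rhoK -psiF// inE; exists n.
  have := ijc t (II' t It); rewrite -hi -rhoi -/(g (q2 t)) => le1.
  have : mdist (s n) (rho (h (i (q1 t)))) < r by rewrite -{1}sn rhoi hi ii.
  have := metric_triangle (q1 t) (s n) (g (q2 t)).
  have := metric_triangle (s n) (rho (h (i (q1 t)))) (g (q2 t)).
  by rewrite (metric_sym (q1 t) (s n)); move: nt le1; rewrite /g /=; lra.
have [f1 [mf1 f1mu f1q]] := parameter_extension p1.
have [f2 [mf2 f2m f2q]] := parameter_extension p2.
have mg := measurable_isometry gi.
have mf2g : measurable_fun setT ((g : borel Y -> borel U) \o f2).
  exact: measurableT_comp.
have f2g (B : set (borel U)) : measurable B -> uniform01 ((g \o f2) @^-1` B) = image_meas gi (mm_meas Y) B.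
  move=> mB; apply: (f2m (g @^-1` B)).
  by rewrite -[X in measurable X]setTI; exact: mg.
have mA : measurable (A : set (borel U)).
  by apply: bigcup_measurable => n _; apply: open_borel; exact: open_ball_metric.
have mf1A : measurable (f1 @^-1` A).
  by rewrite -[X in measurable X]setTI; exact: mf1.
pose G := I `&` f1 @^-1` A.
have mG : measurable G by exact: measurableI.
have Gc t : G t -> mdist (f1 t : U) ((g \o f2) t) <= c + 2 * r.
  move=> [It]; have I01t := I01 _ It.
  by rewrite /= f1q// f2q// => At; exact: close.
have IC : (uniform01 (~` I) <= e%:E)%E.
  have : lebesgue_measure I \is a fin_num.
    by rewrite -(setIidr I01) -uniform01E fin_num_measure.
  have -> : uniform01 (~` I) = (1 - lebesgue_measure I)%E.
    by rewrite -[in RHS](setIidr I01) -uniform01E; exact: probability_setC.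
  by move: Ie => /[swap] /fineK <-; rewrite -EFinB !lee_fin; lra.
have AC : (uniform01 (~` (f1 @^-1` A)) <= r%:E)%E.
  by rewrite preimage_setC f1mu//; exact: measurableC.
have GC : (uniform01 (~` G) <= (e + r)%:E)%E.
  rewrite setCI EFinD; apply: le_trans (measureU2 _ _ _) _; last exact: leeD.
  - exact: measurableC.
  - exact: measurableC.
have c2r : 0 <= c + 2 * r by apply: addr_ge0; [exact: ltW|rewrite mulr_ge0 // ltW].
have fin : ((c + 2 * r)%:E + uniform01 (~` G) <= (3 / 2 * e + dl)%:E)%E.
  apply: (@le_trans _ _ ((c + 2 * r)%:E + (e + r)%:E)%E); first exact: leeD.
  by rewrite -EFinD lee_fin /c /r; lra.
exists g, gi; split; apply: le_trans fin.
  exact: (W_le mf1 mf2g).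
apply: (W_le mf2g mf1) => // t Gt; rewrite metric_sym; exact: Gc.
Qed.

(** Restates membership in the class as an isomorphism, so that [le_box_mm] can replace [rep x] by U
    equipped with mu. *)
Lemma mem_PhiP (x : X1 R) (mu : probability (borel U) R) :
  sval (Phi U x) mu <-> mm_iso (rep x) (MMSpace (ury_separable U) mu).
Proof.
have XPhi := iso_image_meas (@embedding_isometry _ U (rep x)) (mm_meas (rep x))
  (@mm_separable _ (rep x)).
split=> [|iXmu]; first exact: iso_meas_trans.
apply: (iso_meas_trans _ iXmu).
by apply: iso_meas_sym => //; exact: mm_separable.
Qed.

Lemma inf_W_le_box (x y : X1 R) (mu : probability (borel U) R) :
  sval (Phi U x) mu ->
  (ereal_inf [set W mu nu | nu in sval (Phi U y)] <= (3 / 2)%:E * box x y)%E /\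
  (ereal_inf [set W nu mu | nu in sval (Phi U y)] <= (3 / 2)%:E * box x y)%E.
Proof.
move=> /mem_PhiP xmu.
have YPhi (g : rep y -> U) (gi : Defs.isometry g) :
    sval (Phi U y) (image_meas gi (mm_meas (rep y))).
  by apply/mem_PhiP; apply: iso_image_meas; exact: mm_separable.
set S1 := [set W mu nu | nu in _]; set S2 := [set W nu mu | nu in _].
(* Bounding the maximum handles both infima in one pass through the infima that define the box
   distance. *)
suff main : (maxe (ereal_inf S1) (ereal_inf S2) <= (3 / 2)%:E * box x y)%E.
  by move: main; rewrite ge_max => /andP[].
rewrite -lee_pdivrMl//; apply: (@le_trans _ _
    (box_mm (MMSpace (ury_separable U) mu) (rep y))); last first.
  by apply: le_box_mm; [exact: mm_iso_sym|exact: mm_iso_refl].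
apply: le_ereal_inf_tmp => _ [q1 [q2 [p1 p2 ->]]].
apply: le_ereal_inf_tmp => _ [e [/andP[e0 _] [I [mI I01 Ie Id]]] <-].
rewrite lee_pdivrMl//; apply/lee_addgt0Pr => d d0.
have [g [gi [W1 W2]]] := W_le_box p1 p2 e0 mI I01 Ie Id d0.
rewrite ge_max; apply/andP; split.
  by apply: le_trans W1; apply: ereal_inf_lbound; exists (image_meas gi (mm_meas (rep y))).
by apply: le_trans W2; apply: ereal_inf_lbound; exists (image_meas gi (mm_meas (rep y))).
Qed.

Lemma box_sqr_le_inf_W (x y : X1 R) (mu : probability (borel U) R) :
  sval (Phi U x) mu ->
  ((2^-1)%:E * box x y ^+ 2 <= ereal_inf [set W mu nu | nu in sval (Phi U y)])%E.
Proof.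
move=> /mem_PhiP xmu; apply: le_ereal_inf_tmp => _ [nu /mem_PhiP ynu <-].
apply: le_ereal_inf_tmp => _ [p cp <-]; apply: le_trans (box_mm_coupling_le cp).
apply: lee_wpmul2l => //; rewrite lee_sqr; [|exact: box_mm_ge0..].
exact: le_box_mm.
Qed.

End wasserstein_bound.
End upper_bound.

Unset Implicit Arguments.
Local Open Scope ereal_scope.

Theorem theorem5p2 (R : realType) (U : urysohn R) (x y : X1 R) :
  (2^-1)%:E * box x y ^+ 2 <= d_mG U x y /\
  d_mG U x y <= (3 / 2)%:E * box x y.
Proof.
split.
  (* The lower bound holds at every measure of the class, and one of them already bounds the
     supremum in [W_H] from below. *)
  pose mu := image_meas (@embedding_isometry _ U (rep x)) (mm_meas (rep x)).
  have xmu : sval (Phi U x) mu.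
    by apply/mem_PhiP; apply: iso_image_meas; exact: mm_separable.
  apply: le_trans (box_sqr_le_inf_W y xmu) _; rewrite le_max; apply/orP; left.
  by apply: ereal_sup_ubound; exists mu.
rewrite ge_max; apply/andP; split; apply: ge_ereal_sup => _ [mu mux <-].
  by have [] := inf_W_le_box y mux.
(* In the second supremum the classes exchange roles, which yields [box y x]; symmetry of the box
   distance concludes. *)
have [_ h] := inf_W_le_box x mux; apply: le_trans h _.
by rewrite lee_pmul2l//; exact: box_mm_sym.
Qed.
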